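(* $$\int_0^\infty f(t)\operatorname{erfc}(a\sqrt{t})\,dt=\frac{2}{\pi}\int_0^{\pi/2}F(a^2\sec^2(\theta))\,d\theta=\frac{2a}{\pi}\int_a^\infty\frac{F(s^2)}{s\sqrt{s^2-a^2}}\,ds,$$ where $F(s)=(\mathcal{L}f)(s)$ is the Laplace transform of $f(t)$.
   Context: The Laplace transform of $f$ is $F(s)=(\mathcal{L}f)(s)=\int_0^\infty f(t)e^{-st}\,dt$. The complementary error function is $\operatorname{erfc}(x)=1-\operatorname{erf}(x)$, where $\operatorname{erf}(x)=\frac{2}{\sqrt{\pi}}\int_0^x e^{-u^2}\,du$ is the error function. *)

(* Defs.v *)
From mathcomp Require Import all_boot all_order all_algebra.
From mathcomp Require Import all_classical all_reals all_analysis.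

Set Implicit Arguments.
Unset Strict Implicit.
Unset Printing Implicit Defensive.

Import Order.TTheory GRing.Theory Num.Theory.
Import numFieldNormedType.Exports.

Local Open Scope classical_set_scope.
Local Open Scope ring_scope.

(* The integral from 0 to x is oriented, hence the sign when x < 0. *)
Definition erf (R : realType) (x : R) : R :=
  2 / Num.sqrt pi *
  (if 0 <= x
   then \int[lebesgue_measure]_(u in `[0, x]) expR (- u ^+ 2)
   else - \int[lebesgue_measure]_(u in `[x, 0]) expR (- u ^+ 2)).

Definition erfc (R : realType) (x : R) : R := 1 - erf x.

Definition sec (R : realType) (x : R) : R := (cos x)^-1.

(* Extended-real valued, so that no default value has to be assigned at an s
   where the defining Lebesgue integral is not finite. *)
Definition laplace (R : realType) (f : R -> R) (s : R) : \bar R :=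
  (\int[lebesgue_measure]_(t in `[0%R, +oo[) (f t * expR (- (s * t)))%:E)%E.

(* Main.v *)
Require Import Defs.
From mathcomp Require Import all_boot all_order all_algebra.
From mathcomp Require Import all_classical all_reals all_analysis.
From mathcomp Require Import measurable_realfun ring lra.

Set Implicit Arguments.
Unset Strict Implicit.
Unset Printing Implicit Defensive.

Import Order.TTheory GRing.Theory Num.Theory.
Import numFieldNormedType.Exports.

Local Open Scope classical_set_scope.
Local Open Scope ring_scope.

(** Everything rests on Craig's formula for the complementary error function:
    for x >= 0,
      erfc x = (2 / pi) int_0^(pi/2) exp (- x^2 sec^2 theta) dtheta.
    With x = a sqrt t this reads: erfc (a sqrt t) is, up to a constant, an
    integral over theta of the Laplace kernels exp (- s t) with
    s = a^2 sec^2 theta. Integrating f against it and exchanging the two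
    integrals turns each kernel into the Laplace transform of f at s. The second
    form is the same computation after the change of variable s = a sec theta,
    which is made on the kernel: this is a nonnegative continuous function, so
    the change of variable is elementary for it.

    Craig's formula is reduced by u = tan theta to the rational form
      int_0^oo exp (- x^2 (1 + u^2)) / (1 + u^2) du = (pi / 2) erfc x
    ([craig_rational]). There the integrand is a Gaussian tail,
      exp (- x^2 c) / c = int_x^oo 2 y exp (- y^2 c) dy   with c = 1 + u^2,
    so by Tonelli the integral over u can be done first; it is a Gaussian
    integral of value sqrt pi exp (- y^2), and integrating this over y > x gives
    erfc x. The two forms used in the theorem are [craig_sec], with
    u = tan theta, and [craig_hyperbola], with s = a sqrt (1 + u^2).

    The exchange of integrals ([integral_kernel_transform]) is legitimate because
    the kernel is nonnegative: Tonelli applied to |f| gives a constant times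
    int |f t| erfc (a sqrt t) dt, which is finite by assumption. The
    function f is measurable, being the quotient of the integrable product
    f t * erfc (a sqrt t) by a positive measurable function. The transform
    F may be infinite at exceptional points, such as s = a^2. This is harmless:
    the integral of F does not see null sets, and a positive weight can be moved
    across the integral defining F whatever the value of the latter
    ([integralZr_gt0]). *)

(** * Measurability of inversion *)

(** The convention 0^-1 = 0 makes inversion the extension by zero of its
    restriction to the nonzero reals, where it is continuous. *)
Lemma measurable_inv (R : realType) : measurable_fun [set: R] (@GRing.inv R).
Proof.
pose N := [set x : R | x != 0].
have oN : open N.
  rewrite (_ : N = ~` [set 0]); last by apply/seteqP; split => x /= /eqP.
  by apply: closed_openC; exact: closed_eq.
have -> : @GRing.inv R = (@GRing.inv R) \_ N.
  apply/funext => x; rewrite patchE; case: ifPn => //.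
  by rewrite notin_setE /N/= => /negP; rewrite negbK => /eqP ->; rewrite invr0.
apply/(measurable_restrictT (@GRing.inv R)); first exact: open_measurable.
have cN : {in N, continuous (@GRing.inv R)}.
  by move=> x; rewrite inE => x0; exact: inv_continuous.
exact: (open_continuous_measurable_fun oN cN).
Qed.

(** * Change of variables on the positive half-line *)

(** The substitution rule on the compact intervals [1/(n+1), n+1] passes to the
    limit by monotone convergence. All hypotheses bear on
    interior points only, so that [G] may blow up at an end of [E], as
    1 / sqrt (s^2 - a^2) does at s = a. *)
Lemma ge0_integral_substitution0y (R : realType) (F G f : R -> R) (E : set R) :
  (forall u : R, 0 < u -> is_derive u 1 F (f u)) ->
  (forall u : R, 0 < u -> {for u, continuous f}) ->
  (forall u : R, 0 < u -> 0 < f u) ->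
  is_interval E ->
  (forall u : R, 0 < u -> E (F u)) ->
  (forall v, E v -> exists2 u : R, 0 < u & F u = v) ->
  (forall v, E v -> {for v, continuous G}) ->
  (forall v, E v -> 0 <= G v) ->
  (\int[lebesgue_measure]_(v in E) (G v)%:E =
   \int[lebesgue_measure]_(u in `]0%R, +oo[) (G (F u) * f u)%:E)%E.
Proof.
move=> dF cf f0 iE FE EF cG G0.
have derF (u : R) : 0 < u -> derivable F u 1 by move=> /dF[].
have F'E (u : R) : 0 < u -> derive1 F u = f u.
  by move=> u0; rewrite derive1E; have [_ ->] := dF _ u0.
have cF (u : R) : 0 < u -> {for u, continuous F}.
  by move=> u0; apply/differentiable_continuous/derivable1_diffP/derF.
have cF' (u : R) : 0 < u -> {for u, continuous (derive1 F)}.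
  move=> u0; rewrite /prop_for /continuous_at F'E//; apply: cvg_trans (cf _ u0).
  apply: near_eq_cvg; near=> v; rewrite F'E//.
  by near: v; exact: lt_nbhsr.
have F_homo (u v : R) : 0 < u -> u < v -> F u < F v.
  move=> u0 uv; apply: (@gtr0_derive1_lt_cc _ F u v) => //.
  - by move=> x /itvP xuv; apply: derF; rewrite (lt_trans u0)// xuv.
  - move=> x /itvP xuv; have x0 : 0 < x by rewrite (lt_trans u0)// xuv.
    by rewrite F'E// f0.
  - apply: continuous_in_subspaceT => x; rewrite inE/= => /itvP xuv.
    by apply: cF; rewrite (lt_le_trans u0)// xuv.
  - by rewrite in_itv/= lexx ltW.
  - by rewrite in_itv/= lexx ltW.
have F_le (u v : R) : 0 < u -> u <= v -> F u <= F v.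
  by move=> u0; rewrite le_eqVlt => /predU1P[->//|/(F_homo _ _ u0)/ltW].
pose a n : R := n.+1%:R^-1; pose b n : R := n.+1%:R.
have a0 n : 0 < a n by rewrite invr_gt0.
have ab n : a n <= b n.
  rewrite (@le_trans _ _ 1)//; last by rewrite /b ler1n.
  by rewrite invf_le1// ler1n.
have b0 n : 0 < b n by [].
have nda n m : (n <= m)%N -> a m <= a n.
  by move=> nm; rewrite lef_pV2 ?posrE// ler_nat ltnS.
have ndb n m : (n <= m)%N -> b n <= b m by move=> nm; rewrite ler_nat ltnS.
have UA : \bigcup_n `[a n, b n]%classic = `]0, +oo[%classic.
  apply/seteqP; split => x /=.
    by move=> [n _] /= /itvP xn; rewrite in_itv/= andbT (lt_le_trans (a0 n))// xn.
  rewrite in_itv/= andbT => x0.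
  have [n xn] : exists n, x <= b n.
    by exists (Num.truncn x); exact/ltW/truncnS_gt.
  have [m xm] : exists n, a n <= x.
    exists (Num.truncn x^-1); rewrite /a invf_ple ?posrE//.
    exact/ltW/truncnS_gt.
  exists (maxn n m) => //=; rewrite in_itv/= (le_trans _ xm) ?(le_trans xn)//.
    by rewrite ndb// leq_maxl.
  by rewrite nda// leq_maxr.
have UE : \bigcup_n `[F (a n), F (b n)]%classic = E.
  apply/seteqP; split => [v [n _] /=|v /EF[u u0 <-]].
    rewrite in_itv/= => vn; apply: (iE (F (a n)) (F (b n))) => //; exact: FE.
  have : (\bigcup_n `[a n, b n]%classic) u by rewrite UA /= in_itv/= u0.
  case=> n _ /= /itvP un; exists n => //=; rewrite in_itv/=.
  by rewrite !F_le ?un.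
have subE n : `[F (a n), F (b n)]%classic `<=` E.
  by rewrite -UE => v vn; exists n.
have sub0 n : `[a n, b n]%classic `<=` `]0, +oo[%classic.
  by rewrite -UA => v vn; exists n.
have gt0 n x : x \in `[a n, b n] -> 0 < x.
  by move=> /sub0/=; rewrite in_itv/= andbT.
have cGn n : {within `[F (a n), F (b n)], continuous G}.
  by apply: continuous_in_subspaceT => v; rewrite inE => /subE; exact: cG.
have cfn n : {within `[a n, b n], continuous (fun u => G (F u) * f u)}.
  apply: continuous_in_subspaceT => v; rewrite inE => /gt0 v0.
  apply: continuousM; last exact: cf.
  by apply: continuous_comp; [exact: cF|exact/cG/FE].
have H n : (\int[lebesgue_measure]_(v in `[F (a n), F (b n)]) (G v)%:E =
    \int[lebesgue_measure]_(u in `[a n, b n]%classic) (G (F u) * f u)%:E)%E.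
  rewrite (integration_by_substitution_increasing (ab n)).
  - by apply: eq_integral => u; rewrite inE => /gt0 u0; rewrite !fctE F'E.
  - by move=> x y /gt0 x0 _; exact: F_homo.
  - by move=> x /subset_itv_oo_cc/gt0; exact: cF'.
  - apply/cvg_ex; exists (derive1 F (a n)).
    by apply: cvg_at_right_filter; exact: cF'.
  - apply/cvg_ex; exists (derive1 F (b n)).
    by apply: cvg_at_left_filter; exact: cF'.
  - split; first by move=> x /subset_itv_oo_cc/gt0; exact: derF.
    + by apply: cvg_at_right_filter; exact: cF.
    + by apply: cvg_at_left_filter; exact: cF.
  - exact: cGn.
have L : (\int[lebesgue_measure]_(v in `[F (a n), F (b n)]) (G v)%:E @[n --> \oo]
    --> \int[lebesgue_measure]_(v in E) (G v)%:E)%E.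
  rewrite -UE; apply: ge0_nondecreasing_set_cvg_integral => //.
  - move=> n m nm; rewrite subsetEset; apply: subset_itv;
    by rewrite bnd_simp F_le// ?nda// ndb.
  - move=> n; apply/measurable_EFinP.
    exact: subspace_continuous_measurable_fun.
  - by move=> n v /subE /G0; rewrite lee_fin.
have R0 : (\int[lebesgue_measure]_(u in `[a n, b n]) (G (F u) * f u)%:E @[n --> \oo]
    --> \int[lebesgue_measure]_(u in `]0%R, +oo[) (G (F u) * f u)%:E)%E.
  rewrite -UA; apply: ge0_nondecreasing_set_cvg_integral => //.
  - move=> n m nm; rewrite subsetEset; apply: subset_itv;
    by rewrite bnd_simp ?nda ?ndb.
  - move=> n; apply/measurable_EFinP.
    exact: subspace_continuous_measurable_fun.
  - move=> n v /gt0 v0; rewrite lee_fin mulr_ge0//; first exact/G0/FE.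
    exact/ltW/f0.
rewrite (funext H) in L; exact: (cvg_unique _ L R0).
Unshelve. all: end_near. Qed.

(** * Exchanging integrals over a product *)

Section product_integrals.
Local Open Scope ereal_scope.
Context d1 d2 (T1 : measurableType d1) (T2 : measurableType d2) (R : realType).
Variable m1 : {sigma_finite_measure set T1 -> \bar R}.
Variable m2 : {sigma_finite_measure set T2 -> \bar R}.
Variables (A : set T1) (B : set T2).
Hypotheses (mA : measurable A) (mB : measurable B).

(** Integrals over a rectangle are integrals over the whole product of the
    extension by zero; this and the next lemmas transfer the theorems of Tonelli
    and Fubini to rectangles. *)
Lemma integral_patchX1 (h : T1 * T2 -> \bar R) (x : T1) :
  \int[m2]_y (h \_ (A `*` B)) (x, y)
  = ((fun x => \int[m2]_(y in B) h (x, y)) \_ A) x.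
Proof.
rewrite patchE; case: ifPn => xA.
  rewrite [RHS]integral_mkcond; apply: eq_integral => y _.
  by rewrite !patchE in_setX xA.
apply: integral0_eq => y _.
by rewrite patchE in_setX (negbTE xA).
Qed.

Lemma integral_patchX2 (h : T1 * T2 -> \bar R) (y : T2) :
  \int[m1]_x (h \_ (A `*` B)) (x, y)
  = ((fun y => \int[m1]_(x in A) h (x, y)) \_ B) y.
Proof.
rewrite patchE; case: ifPn => yB.
  rewrite [RHS]integral_mkcond; apply: eq_integral => x _.
  by rewrite !patchE in_setX yB andbT.
apply: integral0_eq => x _.
by rewrite patchE in_setX (negbTE yB) andbF.
Qed.

Lemma integral_patchX (h : T1 * T2 -> \bar R) :
  \int[m1]_x \int[m2]_y (h \_ (A `*` B)) (x, y)
  = \int[m1]_(x in A) \int[m2]_(y in B) h (x, y).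
Proof.
rewrite [RHS]integral_mkcond; apply: eq_integral => x _.
exact: integral_patchX1.
Qed.

Let mX (h : T1 * T2 -> \bar R) :
  measurable_fun [set: T1 * T2] h -> measurable_fun [set: T1 * T2] (h \_ (A `*` B)).
Proof.
move=> mh; apply/(measurable_restrictT h); first exact: measurableX.
exact: measurable_funTS.
Qed.

Lemma measurable_fun_integralX (h : T1 * T2 -> \bar R) :
  measurable_fun [set: T1 * T2] h ->
  (forall x y, A x -> B y -> 0 <= h (x, y)) ->
  measurable_fun A (fun x => \int[m2]_(y in B) h (x, y)).
Proof.
move=> mh h0.
apply/(measurable_restrictT (fun x => \int[m2]_(y in B) h (x, y))) => //.
have -> : (fun x => \int[m2]_(y in B) h (x, y)) \_ A = fubini_F m2 (h \_ (A `*` B)).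
  by apply/funext => x; rewrite -integral_patchX1.
apply: measurable_fun_fubini_tonelli_F; first exact: mX.
by move=> z; apply: erestrict_ge0 => -[x y] [? ?]; exact: h0.
Qed.

Lemma fubini_tonelliX (h : T1 * T2 -> \bar R) :
  measurable_fun [set: T1 * T2] h ->
  (forall x y, A x -> B y -> 0 <= h (x, y)) ->
  \int[m1]_(x in A) \int[m2]_(y in B) h (x, y)
  = \int[m2]_(y in B) \int[m1]_(x in A) h (x, y).
Proof.
move=> mh h0; rewrite -integral_patchX [RHS]integral_mkcond.
rewrite (fubini_tonelli (h \_ (A `*` B))); first last.
- by move=> z; apply: erestrict_ge0 => -[x y] [? ?]; exact: h0.
- exact: mX.
by apply: eq_integral => y _; exact: integral_patchX2.
Qed.

Lemma FubiniX (h : T1 * T2 -> \bar R) :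
  measurable_fun (A `*` B) h ->
  \int[m1]_(x in A) \int[m2]_(y in B) `|h (x, y)| < +oo ->
  \int[m1]_(x in A) \int[m2]_(y in B) h (x, y)
  = \int[m2]_(y in B) \int[m1]_(x in A) h (x, y).
Proof.
move=> mh hoo; rewrite -integral_patchX [RHS]integral_mkcond.
have mhX : measurable_fun [set: T1 * T2] (h \_ (A `*` B)).
  by apply/(measurable_restrictT h) => //; exact: measurableX.
rewrite (Fubini (f := h \_ (A `*` B))).
  by apply: eq_integral => y _; exact: integral_patchX2.
apply/integrable12ltyP => //.
rewrite -(integral_patchX (abse \o h)) in hoo.
apply: le_lt_trans hoo; rewrite le_eqVlt; apply/orP; left; apply/eqP.
apply: eq_integral => x _; apply: eq_integral => y _.
by rewrite restrict_abse.
Qed.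

(** [g] is measurable as a partial integral, and [f] is the quotient of [f * g]
    by it. *)
Lemma measurable_of_kernel (k : T1 * T2 -> R) (f g : T1 -> R) :
  measurable_fun [set: T1 * T2] k ->
  (forall x y, A x -> B y -> 0 <= k (x, y))%R ->
  (forall x, A x -> 0 < g x)%R ->
  (forall x, A x -> \int[m2]_(y in B) (k (x, y))%:E = (g x)%:E) ->
  m1.-integrable A (fun x => (f x * g x)%:E) ->
  measurable_fun A f.
Proof.
move=> mk k0 g0 gE /measurable_int/measurable_EFinP mfg.
have mg : measurable_fun A g.
  apply/measurable_EFinP.
  apply: (@eq_measurable_fun _ _ _ _ _ (fun x => \int[m2]_(y in B) (k (x, y))%:E)).
    by move=> x; rewrite inE => Ax; exact: gE.
  apply: (@measurable_fun_integralX (EFin \o k)); first exact/measurable_EFinP.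
  by move=> x y Ax By; rewrite lee_fin k0.
apply: (@eq_measurable_fun _ _ _ _ _ (fun x => f x * g x * (g x)^-1)%R).
  by move=> x; rewrite inE => Ax; rewrite mulfK// gt_eqF// g0.
apply: measurable_funM => //.
by apply: measurableT_comp => //; exact: measurable_inv.
Qed.

(** Since [k] is nonnegative, integrating [`|f x| * k (x, y)] over [y] first gives
    [`|f x * g x|], so the integrability of [f * g] is exactly what Fubini's
    theorem requires. *)
Lemma integral_kernel_transform (k : T1 * T2 -> R) (f g : T1 -> R) :
  measurable_fun [set: T1 * T2] k ->
  (forall x y, A x -> B y -> 0 <= k (x, y))%R ->
  (forall x, A x -> 0 < g x)%R ->
  (forall x, A x -> \int[m2]_(y in B) (k (x, y))%:E = (g x)%:E) ->
  m1.-integrable A (fun x => (f x * g x)%:E) ->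
  \int[m2]_(y in B) \int[m1]_(x in A) (f x * k (x, y))%:E
  = \int[m1]_(x in A) (f x * g x)%:E.
Proof.
move=> mk k0 g0 gE ifg.
have mf : measurable_fun A f by exact: measurable_of_kernel gE ifg.
have mkx x : measurable_fun B (fun y => k (x, y)).
  by apply: measurable_funTS; exact: measurable_fun_pair2.
rewrite -(@FubiniX (fun z => (f z.1 * k z)%:E)).
- apply: eq_integral => x; rewrite inE => Ax /=.
  under eq_integral do rewrite EFinM.
  rewrite integralZl// ?gE//; apply/integrableP; split.
    exact/measurable_EFinP.
  under eq_integral => y do [rewrite inE => By; rewrite gee0_abs ?lee_fin ?k0//].
  by rewrite gE// ltry.
- apply/measurable_EFinP; apply: measurable_funM; last exact: measurable_funTS.
  apply: (measurable_comp mA) => //; last exact: measurable_funTS.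
  by move=> _ [[x y] [Ax By] <-].
- move/integrableP : ifg => -[_]; apply: le_lt_trans.
  rewrite le_eqVlt; apply/orP; left; apply/eqP.
  apply: eq_integral => x; rewrite inE => Ax /=.
  rewrite normrM (gtr0_norm (g0 _ Ax)) EFinM -gE//.
  rewrite -ge0_integralZl_EFin//.
  + apply: eq_integral => y; rewrite inE => By.
    by rewrite normrM (ger0_norm (k0 _ _ Ax By)).
  + by move=> y By; rewrite lee_fin k0.
  + exact/measurable_EFinP.
Qed.

End product_integrals.

(** * Weighted integrals of Laplace transforms *)

(** The positive and negative parts of [f] scale separately. When both have an
    infinite integral, the two sides still agree: they are [-oo], by the
    convention [+oo - oo = -oo]. *)
Lemma integralZr_gt0 d (T : measurableType d) (R : realType)
    (mu : {measure set T -> \bar R}) (D : set T) (f : T -> R) (c : R) :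
  measurable D -> measurable_fun D f -> 0 < c ->
  (\int[mu]_(x in D) (f x * c)%:E = (\int[mu]_(x in D) (f x)%:E) * c%:E)%E.
Proof.
move=> mD mf c0; have mEf : measurable_fun D (EFin \o f) by exact/measurable_EFinP.
under eq_integral do rewrite mulrC EFinM.
rewrite muleC integralE [in RHS]integralE.
rewrite (ge0_funeposM (EFin \o f) (ltW c0)) (ge0_funenegM (EFin \o f) (ltW c0)).
rewrite !ge0_integralZl_EFin ?ltW//;
  [|exact: measurable_funeneg|exact: measurable_funepos].
have := @integral_ge0 _ _ _ mu D _ (fun x _ => funepos_ge0 (EFin \o f) x).
have := @integral_ge0 _ _ _ mu D _ (fun x _ => funeneg_ge0 (EFin \o f) x).
move: (integral _ _ (_^\+)%E) (integral _ _ (_^\-)%E) => [p| |] [q| |] //= _ _.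
- by congr EFin; rewrite -mulrBr.
- by rewrite gt0_muley ?lte_fin// gt0_muleNy ?lte_fin.
- by rewrite gt0_muley ?lte_fin//= gt0_muley ?lte_fin.
- by rewrite gt0_muley ?lte_fin//= gt0_muleNy ?lte_fin.
Qed.

(** The kernel transform for [k (t, y) = exp (- phi y * t) * w y], whose integral
    against [f] in [t] is the Laplace transform of [f] at [phi y], weighted. *)
Lemma integral_laplace_weighted (R : realType) (D : set R) (phi w f g : R -> R) :
  measurable D ->
  measurable_fun [set: R] phi -> measurable_fun [set: R] w ->
  (forall y, D y -> 0 < w y) ->
  (forall t : R, 0 <= t -> 0 < g t) ->
  (forall t : R, (0 <= t)%R ->
    \int[lebesgue_measure]_(y in D) (expR (- (phi y * t)) * w y)%:E
    = (g t)%:E)%E ->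
  lebesgue_measure.-integrable `[0, +oo[ (fun t => (f t * g t)%:E) ->
  (\int[lebesgue_measure]_(y in D) (laplace f (phi y) * (w y)%:E)
   = \int[lebesgue_measure]_(t in `[0%R, +oo[) (f t * g t)%:E)%E.
Proof.
move=> mD mphi mw w0 g0 gE ifg.
pose mu : {sigma_finite_measure set (measurableTypeR R) -> \bar R} := lebesgue_measure.
pose A : set R := `[0, +oo[%classic.
have mA : measurable A by exact: measurable_itv.
pose k (z : R * R) := expR (- (phi z.2 * z.1)) * w z.2.
have me : measurable_fun [set: R * R] (fun z => expR (- (phi z.2 * z.1))).
  apply: measurableT_comp => //; apply: measurableT_comp => //.
  apply: measurable_funM => //; exact: measurableT_comp.
have mk : measurable_fun [set: R * R] k.
  by apply: measurable_funM => //; exact: measurableT_comp.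
have k0 t y : A t -> D y -> 0 <= k (t, y).
  by move=> _ Dy; rewrite mulr_ge0 ?expR_ge0// ltW// w0.
have g0' t : A t -> 0 < g t.
  by rewrite /A /= in_itv/= andbT; exact: g0.
have gE' t : A t ->
    (\int[lebesgue_measure]_(y in D) (k (t, y))%:E = (g t)%:E)%E.
  by rewrite /A /= in_itv/= andbT; exact: gE.
have mf : measurable_fun A f.
  exact: (measurable_of_kernel (m1 := mu) (m2 := mu) mA mD mk k0 g0' gE' ifg).
rewrite -(integral_kernel_transform (m1 := mu) (m2 := mu) mA mD mk k0 g0' gE' ifg)//.
apply: eq_integral => y; rewrite inE => Dy.
rewrite -integralZr_gt0 ?w0//.
  by apply: eq_integral => t _; rewrite /k mulrA.
apply: measurable_funM => //; apply: measurable_funTS.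
exact: (measurable_fun_pair1 y me).
Qed.

(** * Gaussian tails and the error function *)

Lemma integral0y_gauss_oo (R : realType) :
  (\int[lebesgue_measure]_(v in `]0%R, +oo[) (@gauss_fun R v)%:E
   = (Num.sqrt pi / 2)%:E)%E.
Proof.
rewrite integral_itv_obnd_cbnd ?integral0y_gauss//.
by apply/measurable_EFinP/measurable_funTS; exact: measurable_gauss_fun.
Qed.

Lemma integral0y_gauss_scale (R : realType) (y : R) : 0 < y ->
  (\int[lebesgue_measure]_(u in `]0%R, +oo[) (gauss_fun (y * u) * y)%:E
   = (Num.sqrt pi / 2)%:E)%E.
Proof.
move=> y0; rewrite -integral0y_gauss_oo; apply/esym.
apply: (@ge0_integral_substitution0y _ (fun u => y * u) gauss_fun (cst y)) => //.
- move=> u u0; apply: is_derive_eq.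
  by rewrite /GRing.scale/= mulr1.
- by move=> u _; exact: cvg_cst.
- exact: interval_is_interval.
- by move=> u u0; rewrite /= in_itv/= andbT mulr_gt0.
- move=> v; rewrite /= in_itv/= andbT => v0; exists (y^-1 * v).
    by rewrite mulr_gt0// invr_gt0.
  by rewrite mulVKf// gt_eqF.
- by move=> v _; exact: continuous_gauss_fun.
- by move=> v _; exact: gauss_fun_ge0.
Qed.

(** The integrand is the derivative of [- expR (- (y ^+ 2 * c)) / c], which
    vanishes at infinity. *)
Lemma integral_gauss_tail_primitive (R : realType) (x c : R) : 0 <= x -> 0 < c ->
  (\int[lebesgue_measure]_(y in `]x, +oo[) (2 * y * expR (- (y ^+ 2 * c)))%:E
   = (expR (- (x ^+ 2 * c)) / c)%:E)%E.
Proof.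
move=> x0 c0.
pose p y : R := 2 * y * expR (- (y ^+ 2 * c)).
pose P y : R := - (expR (- (y ^+ 2 * c)) / c).
have dP (y : R) : is_derive y 1 P (p y).
  rewrite /P /p; apply: is_derive_eq.
  rewrite /GRing.scale/=; field.
  by rewrite gt_eqF.
have cp : continuous p.
  move=> y; apply: continuousM; first by apply: continuousM => //; exact: cvg_cst.
  apply: continuous_comp; last exact: continuous_expR.
  apply: continuousN; apply: continuousM; last exact: cvg_cst.
  exact: exprn_continuous.
have mp : measurable_fun [set: R] p by exact: continuous_measurable_fun.
have cP : P y @[y --> +oo] --> 0.
  rewrite -[X in _ --> X]oppr0 -[X in _ --> - X](mul0r c^-1).
  apply: cvgN; apply: cvgM; last exact: cvg_cst.
  apply: (cvg_comp (fun y => y ^+ 2 * c) (fun y => expR (- y))); last exact: cvgr_expR.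
  by apply: gt0_cvgMly => //; exact: cvgr_expr2.
rewrite integral_itv_obnd_cbnd; last first.
  by apply/measurable_EFinP; apply: measurable_funTS.
rewrite (@ge0_continuous_FTC2y _ p P x 0)//.
- by rewrite /P sub0e -EFinN opprK.
- by move=> y xy; rewrite mulr_ge0 ?expR_ge0// mulr_ge0// (le_trans x0).
- exact: continuous_subspaceT.
- by apply: cvg_at_right_filter; apply/differentiable_continuous/derivable1_diffP.
- by move=> y _; rewrite derive1E derive_val.
Qed.

(** The half-line Gaussian integral, minus its part over [0, x]. *)
Lemma integral_gauss_tail (R : realType) (x : R) : 0 <= x ->
  (\int[lebesgue_measure]_(y in `]x, +oo[) (gauss_fun y)%:E
   = (Num.sqrt pi / 2 * erfc x)%:E)%E.
Proof.
move=> x0.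
have mg (A : set R) : measurable_fun A (EFin \o @gauss_fun R).
  by apply/measurable_EFinP/measurable_funTS; exact: measurable_gauss_fun.
have g0 (A : set R) : forall y, A y -> (0 <= (EFin \o @gauss_fun R) y)%E.
  by move=> y _; rewrite lee_fin gauss_fun_ge0.
pose I1 := (\int[lebesgue_measure]_(y in `[0%R, x]) (gauss_fun y)%:E)%E.
pose I2 := (\int[lebesgue_measure]_(y in `]x, +oo[) (gauss_fun y)%:E)%E.
have I10 : (0 <= I1)%E by apply: integral_ge0; exact: g0.
have I20 : (0 <= I2)%E by apply: integral_ge0; exact: g0.
have I12 : (I1 + I2 = (Num.sqrt pi / 2)%:E)%E.
  rewrite -integral0y_gauss.
  have -> : `[0, +oo[%classic = `[0, x]%classic `|` `]x, +oo[%classic :> set R.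
    by rewrite -itv_bndbnd_setU ?bnd_simp.
  rewrite ge0_integral_setU//=.
  - exact: mg.
  - exact: g0.
  - rewrite disj_set2E; apply/eqP; rewrite -subset0 => y/=.
    by rewrite !in_itv/= andbT ltNge => -[/andP[_ ->]].
have erfE : erf x = 2 / Num.sqrt pi * fine I1 by rewrite /erf x0.
have p0 : Num.sqrt pi != 0 :> R by rewrite gt_eqF// sqrtr_gt0 pi_gt0.
rewrite /erfc erfE -/I2.
move: I1 I2 I10 I20 I12 {erfE} => [p| |] [q| |]//= _ _ [pq].
have -> : q = Num.sqrt pi / 2 - p by rewrite -pq; ring.
by congr EFin; field.
Qed.

(** The tail integral beyond [x] is bounded below by that of the constant
    [gauss_fun (x + 2)] over the unit interval [x + 1, x + 2]. *)
Lemma erfc_gt0 (R : realType) (x : R) : 0 <= x -> 0 < erfc x.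
Proof.
move=> x0.
have p0 : 0 < Num.sqrt pi :> R by rewrite sqrtr_gt0 pi_gt0.
rewrite -(pmulr_rgt0 _ (divr_gt0 p0 (ltr0Sn _ 1))) -lte_fin -integral_gauss_tail//.
pose c : R := gauss_fun (x + 2).
apply: (@lt_le_trans _ _ (\int[lebesgue_measure]_(y in `[(x + 1)%R, (x + 2)%R]) c%:E)%E).
  rewrite integral_cst//= lebesgue_measure_itv/= lte_fin ltrD2l ltr1n.
  by rewrite -EFinD -EFinM lte_fin mulr_gt0 ?expR_gt0//; lra.
apply: (@le_trans _ _ (\int[lebesgue_measure]_(y in `[(x + 1)%R, (x + 2)%R]) (gauss_fun y)%:E)%E).
  apply: ge0_le_integral => //.
  - by move=> y _; rewrite lee_fin gauss_fun_ge0.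
  - by apply/measurable_EFinP/measurable_funTS; exact: measurable_gauss_fun.
  - move=> y /=; rewrite in_itv/= => /andP[xy yx].
    rewrite lee_fin ler_expR lerN2 ler_pXn2r// nnegrE; lra.
apply: ge0_subset_integral => //.
- by apply/measurable_EFinP/measurable_funTS; exact: measurable_gauss_fun.
- by move=> y _; rewrite lee_fin gauss_fun_ge0.
- by apply: subset_itv; rewrite bnd_simp; lra.
Qed.

(** * Craig's formula *)

(** Writing the integrand as a Gaussian tail over [y > x] and integrating over [u]
    first leaves [Num.sqrt pi * gauss_fun y]. The half-line in [y] is open
    because this value is wrong at [y = 0], where the integral over [u] vanishes. *)
Lemma craig_rational (R : realType) (x : R) : 0 <= x ->
  (\int[lebesgue_measure]_(u in `]0%R, +oo[)
      (expR (- (x ^+ 2 * (1 + u ^+ 2))) / (1 + u ^+ 2))%:E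
   = (pi / 2 * erfc x)%:E)%E.
Proof.
move=> x0.
pose h (z : R * R) := 2 * z.2 * expR (- (z.2 ^+ 2 * (1 + z.1 ^+ 2))).
have mh : measurable_fun [set: R * R] h.
  apply: measurable_funM; first exact: measurable_funM.
  apply: measurableT_comp => //; apply: measurableT_comp => //.
  apply: measurable_funM; first exact: measurable_funX.
  by apply: measurable_funD => //; exact: measurable_funX.
pose mu : {sigma_finite_measure set (measurableTypeR R) -> \bar R} := lebesgue_measure.
transitivity (\int[mu]_(u in `]0%R, +oo[) \int[mu]_(y in `]x, +oo[) (h (u, y))%:E)%E.
  apply: eq_integral => u _.
  have D0 : 0 < 1 + u ^+ 2 by rewrite ltr_pwDl ?sqr_ge0.
  exact/esym/(integral_gauss_tail_primitive x0 D0).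
rewrite (@fubini_tonelliX _ _ _ _ R mu mu _ _ _ _ (EFin \o h))//; first last.
- move=> u y _ /=; rewrite in_itv/= andbT => xy.
  by rewrite lee_fin mulr_ge0 ?expR_ge0// mulr_ge0// (le_trans x0)// ltW.
- exact/measurable_EFinP.
transitivity (\int[mu]_(y in `]x, +oo[) ((Num.sqrt pi)%:E * (gauss_fun y)%:E))%E.
  apply: eq_integral => y; rewrite inE/= in_itv/= andbT => xy.
  have y0 : 0 < y by rewrite (le_lt_trans x0).
  transitivity (\int[mu]_(u in `]0%R, +oo[)
      ((2 * gauss_fun y)%:E * (gauss_fun (y * u) * y)%:E))%E.
    apply: eq_integral => u _; congr EFin.
    rewrite /h /= /gauss_fun mulrDr mulr1 exprMn opprD expRD.
    by ring.
  rewrite ge0_integralZl_EFin//.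
  + by rewrite integral0y_gauss_scale// -!EFinM; congr EFin; field.
  + by move=> u _; rewrite lee_fin mulr_ge0 ?gauss_fun_ge0 ?(ltW y0).
  + apply/measurable_EFinP; apply: measurable_funM => //.
    apply: measurable_funTS; apply: measurableT_comp; first exact: measurable_gauss_fun.
    exact: measurable_funM.
  + by rewrite mulr_ge0// gauss_fun_ge0.
rewrite ge0_integralZl_EFin ?sqrtr_ge0//.
- rewrite integral_gauss_tail// -EFinM mulrA mulrA -expr2 sqr_sqrtr ?pi_ge0//.
- by move=> y _; rewrite lee_fin gauss_fun_ge0.
- by apply/measurable_EFinP/measurable_funTS; exact: measurable_gauss_fun.
Qed.

Lemma measurable_sec (R : realType) : measurable_fun [set: R] (@sec R).
Proof.
rewrite /sec; apply: measurableT_comp; first exact: measurable_inv.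
by apply: continuous_measurable_fun; exact: continuous_cos.
Qed.

(** The substitution [theta = atan u], for which [sec theta ^+ 2 = 1 + u ^+ 2]. *)
Lemma craig_sec (R : realType) (x : R) : 0 <= x ->
  (\int[lebesgue_measure]_(theta in `[0%R, (pi / 2)%R[)
      (expR (- (x ^+ 2 * sec theta ^+ 2)))%:E
   = (pi / 2 * erfc x)%:E)%E.
Proof.
move=> x0; rewrite -craig_rational//.
have mG : measurable_fun [set: R] (fun theta : R => expR (- (x ^+ 2 * sec theta ^+ 2))).
  apply: measurableT_comp => //; apply: measurableT_comp => //.
  by apply: measurable_funM => //; apply: measurable_funX; exact: measurable_sec.
rewrite -integral_itv_obnd_cbnd; last first.
  by apply/measurable_EFinP; exact: measurable_funTS.
have D0 (u : R) : 0 < 1 + u ^+ 2 by rewrite ltr_pwDl ?sqr_ge0.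
rewrite [LHS](_ : _ = \int[lebesgue_measure]_(u in `]0%R, +oo[)
    (expR (- (x ^+ 2 * sec (atan u) ^+ 2)) * (1 + u ^+ 2)^-1)%:E)%E.
  apply: eq_integral => u _; congr EFin.
  by rewrite /sec cos_atan invrK sqr_sqrtr// ltW.
apply: (@ge0_integral_substitution0y R (@atan R)
    (fun theta => expR (- (x ^+ 2 * sec theta ^+ 2))) (fun u => (1 + u ^+ 2)^-1)).
- move=> u _; apply: continuousV; first by rewrite gt_eqF.
  by apply: continuousD; [exact: cvg_cst|exact: exprn_continuous].
- by move=> u _; rewrite invr_gt0.
- exact: interval_is_interval.
- move=> u u0; rewrite /= in_itv/= atan_ltpi2 andbT -(@atan0 R).
  exact: lt_atan.
- move=> v; rewrite /= in_itv/= => /andP[v0 v1].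
  have vN : - (pi / 2) < v by rewrite (lt_trans _ v0)// oppr_lt0 divr_gt0 ?pi_gt0.
  exists (tan v).
    by rewrite /tan divr_gt0 ?sin_gt0_pihalf ?cos_gt0_pihalf ?v0// v1 vN.
  by rewrite tanK// in_itv/= v1 vN.
- move=> v; rewrite /= in_itv/= => /andP[v0 v1].
  have cv : cos v != 0.
    rewrite gt_eqF// cos_gt0_pihalf// v1 (lt_trans _ v0)//.
    by rewrite oppr_lt0 divr_gt0 ?pi_gt0.
  apply: continuous_comp; last exact: continuous_expR.
  apply: continuousN; apply: continuousM; first exact: cvg_cst.
  apply: (@continuous_comp _ _ _ (@sec R) (fun y => y ^+ 2)); last exact: exprn_continuous.
  by apply: continuousV => //; exact: continuous_cos.
- by move=> v _; exact: expR_ge0.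
Qed.

(** The substitution [s = a * Num.sqrt (1 + u ^+ 2)], for which
    [Num.sqrt (s ^+ 2 - a ^+ 2) = a * u]: the weight absorbs [ds] and leaves
    [du / (a * (1 + u ^+ 2))]. *)
Lemma craig_hyperbola (R : realType) (a t : R) : 0 < a -> 0 <= t ->
  (\int[lebesgue_measure]_(s in `]a, +oo[)
      (expR (- (s ^+ 2 * t)) * (s * Num.sqrt (s ^+ 2 - a ^+ 2))^-1)%:E
   = (pi / 2 / a * erfc (a * Num.sqrt t))%:E)%E.
Proof.
move=> a0 t0; pose x := a * Num.sqrt t.
have D0 (u : R) : 0 < 1 + u ^+ 2 by rewrite ltr_pwDl ?sqr_ge0.
pose h u := expR (- (x ^+ 2 * (1 + u ^+ 2))) / (1 + u ^+ 2).
transitivity (\int[lebesgue_measure]_(u in `]0%R, +oo[) (a^-1%:E * (h u)%:E))%E; last first.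
  rewrite ge0_integralZl_EFin//.
  - by rewrite craig_rational ?mulr_ge0 ?sqrtr_ge0 ?ltW// -EFinM; congr EFin; ring.
  - by move=> u _; rewrite lee_fin divr_ge0 ?expR_ge0// ltW.
  - apply/measurable_EFinP/measurable_funTS.
    have m1 : measurable_fun [set: R] (fun u : R => 1 + u ^+ 2).
      by apply: measurable_funD => //; exact: measurable_funX.
    apply: measurable_funM.
      apply: measurableT_comp => //; apply: measurableT_comp => //.
      exact: measurable_funM.
    by apply: measurableT_comp => //; exact: measurable_inv.
  - by rewrite invr_ge0 ltW.
pose F (u : R) := a * Num.sqrt (1 + u ^+ 2).
have sqF (u : R) : F u ^+ 2 = a ^+ 2 * (1 + u ^+ 2).
  by rewrite exprMn sqr_sqrtr// ltW.
pose G (s : R) := expR (- (s ^+ 2 * t)) * (s * Num.sqrt (s ^+ 2 - a ^+ 2))^-1.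
pose f (u : R) := a * u / Num.sqrt (1 + u ^+ 2).
rewrite [RHS](_ : _ = \int[lebesgue_measure]_(u in `]0%R, +oo[) (G (F u) * f u)%:E)%E; last first.
  apply: eq_integral => u; rewrite inE/= in_itv/= andbT => u0; congr EFin.
  rewrite /G /h sqF.
  rewrite [a ^+ 2 * _ - _](_ : _ = (a * u) ^+ 2); last by ring.
  rewrite sqrtr_sqr gtr0_norm ?mulr_gt0//.
  rewrite [a ^+ 2 * _ * t](_ : _ = x ^+ 2 * (1 + u ^+ 2)); last first.
    by rewrite /x exprMn sqr_sqrtr//; ring.
  rewrite /F /f.
  have s0 : 0 < Num.sqrt (1 + u ^+ 2) by rewrite sqrtr_gt0.
  set E := expR _; set S := Num.sqrt _ in s0 *.
  have -> : 1 + u ^+ 2 = S ^+ 2 by rewrite sqr_sqrtr// ltW.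
  by field; rewrite !gt_eqF.
apply: (@ge0_integral_substitution0y R F G f).
- move=> u _; rewrite /F /f.
  have dS : is_derive u 1 (fun v : R => Num.sqrt (1 + v ^+ 2))
      ((2 * u) * (2 * Num.sqrt (1 + u ^+ 2))^-1).
    have dsqrt := is_derive1_sqrt (D0 u).
    apply: (@is_derive_eq _ _ _ _ _ _ _ _ (@is_derive1_comp R Num.sqrt (fun v => 1 + v ^+ 2) u _ _ dsqrt _)).
    by rewrite /GRing.scale/=; field; rewrite gt_eqF// sqrtr_gt0.
  apply: is_derive_eq; rewrite /GRing.scale/=; field.
  by rewrite gt_eqF// sqrtr_gt0.
- move=> u _; apply: continuousM.
    by apply: continuousM; [exact: cvg_cst|exact: cvg_id].
  apply: continuousV; first by rewrite gt_eqF// sqrtr_gt0.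
  apply: (@continuous_comp _ _ _ (fun u : R => 1 + u ^+ 2) Num.sqrt); last exact: sqrt_continuous.
  by apply: continuousD; [exact: cvg_cst|exact: exprn_continuous].
- by move=> u u0; rewrite divr_gt0 ?mulr_gt0// sqrtr_gt0.
- exact: interval_is_interval.
- move=> u u0; rewrite /= in_itv/= andbT /F ltr_pMr//.
  by rewrite -[ltLHS]sqrtr1 ltr_sqrt// ltrDl exprn_gt0.
- move=> s; rewrite /= in_itv/= andbT => as_.
  have sa : 1 < (s / a) ^+ 2 by rewrite exprn_egt1// ltr_pdivlMr// mul1r.
  exists (Num.sqrt ((s / a) ^+ 2 - 1)); first by rewrite sqrtr_gt0 subr_gt0.
  rewrite /F sqr_sqrtr ?subr_ge0 ?ltW// addrC subrK sqrtr_sqr.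
  have s0 := lt_trans a0 as_.
  by rewrite gtr0_norm ?divr_gt0// mulrC divfK// gt_eqF.
- move=> s; rewrite /= in_itv/= andbT => as_.
  have s0 : 0 < s by rewrite (lt_trans a0).
  apply: continuousM.
    apply: continuous_comp; last exact: continuous_expR.
    apply: continuousN; apply: continuousM; last exact: cvg_cst.
    exact: exprn_continuous.
  apply: continuousV.
    rewrite mulf_neq0 ?gt_eqF// sqrtr_gt0 subr_gt0 ltr_pXn2r// nnegrE ltW//.
  apply: continuousM; first exact: cvg_id.
  apply: (@continuous_comp _ _ _ (fun s : R => s ^+ 2 - a ^+ 2) Num.sqrt); last exact: sqrt_continuous.
  by apply: continuousB; [exact: exprn_continuous|exact: cvg_cst].
- move=> s; rewrite /= in_itv/= andbT => as_.
  by rewrite mulr_ge0 ?expR_ge0// invr_ge0 mulr_ge0 ?sqrtr_ge0// ltW// (lt_trans a0).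
Qed.

(** * Integrals against the complementary error function *)

Theorem lemma2p9 (R : realType) (f : R -> R) (a : R) (ha : 0 < a)
    (hf : lebesgue_measure.-integrable `[0, +oo[
            (fun t : R => (f t * erfc (a * Num.sqrt t))%:E)) :
  (\int[lebesgue_measure]_(t in `[0%R, +oo[) (f t * erfc (a * Num.sqrt t))%:E
   = (2 / pi)%:E *
     \int[lebesgue_measure]_(theta in `[0%R, (pi / 2)%R[)
        laplace f (a ^+ 2 * sec theta ^+ 2))%E
  /\
  ((2 / pi)%:E *
     \int[lebesgue_measure]_(theta in `[0%R, (pi / 2)%R[)
        laplace f (a ^+ 2 * sec theta ^+ 2)
   = (2 * a / pi)%:E *
     \int[lebesgue_measure]_(s in `]a, +oo[)
        (laplace f (s ^+ 2) * (s * Num.sqrt (s ^+ 2 - a ^+ 2))^-1%:E))%E.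
Proof.
pose I := (\int[lebesgue_measure]_(t in `[0%R, +oo[) (f t * erfc (a * Num.sqrt t))%:E)%E.
have p0 : 0 < pi :> R by exact: pi_gt0.
have x0 (t : R) : 0 <= a * Num.sqrt t by rewrite mulr_ge0 ?sqrtr_ge0 ?ltW.
have e0 (c t : R) : 0 < c -> 0 < c * erfc (a * Num.sqrt t).
  by move=> c0; rewrite mulr_gt0// erfc_gt0.
have fcE (c : R) : (fun t => (f t * (c * erfc (a * Num.sqrt t)))%:E) =
    (fun t => c%:E * (f t * erfc (a * Num.sqrt t))%:E)%E.
  by apply/funext => t; rewrite -EFinM mulrCA.
have ifc (c : R) : lebesgue_measure.-integrable `[0, +oo[
    (fun t => (f t * (c * erfc (a * Num.sqrt t)))%:E).
  by rewrite fcE; exact: integrableZl.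
have cI (c : R) : (\int[lebesgue_measure]_(t in `[0%R, +oo[)
    (f t * (c * erfc (a * Num.sqrt t)))%:E = c%:E * I)%E.
  by rewrite fcE integralZl.
have secI : (\int[lebesgue_measure]_(theta in `[0%R, (pi / 2)%R[)
    laplace f (a ^+ 2 * sec theta ^+ 2) = (pi / 2)%:E * I)%E.
  rewrite -cI -(@integral_laplace_weighted R `[0, pi / 2[
      (fun theta => a ^+ 2 * sec theta ^+ 2) (cst 1) f
      (fun t => pi / 2 * erfc (a * Num.sqrt t)))//.
  - by apply: eq_integral => theta _; rewrite mule1.
  - by apply: measurable_funM => //; apply: measurable_funX; exact: measurable_sec.
  - by move=> t _; apply: e0; rewrite divr_gt0.
  - move=> t t0; rewrite -craig_sec//; apply: eq_integral => theta _.
    by rewrite mulr1 exprMn sqr_sqrtr// mulrAC.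
have hypI : (\int[lebesgue_measure]_(s in `]a, +oo[)
    (laplace f (s ^+ 2) * (s * Num.sqrt (s ^+ 2 - a ^+ 2))^-1%:E)
    = (pi / 2 / a)%:E * I)%E.
  rewrite -cI (@integral_laplace_weighted R `]a, +oo[
      (fun s => s ^+ 2) (fun s => (s * Num.sqrt (s ^+ 2 - a ^+ 2))^-1) f
      (fun t => pi / 2 / a * erfc (a * Num.sqrt t)))//.
  - apply: measurableT_comp; first exact: measurable_inv.
    apply: measurable_funM => //.
    have msqrt : measurable_fun [set: R] (@Num.sqrt R).
      by apply: continuous_measurable_fun; exact: sqrt_continuous.
    by apply: (measurableT_comp msqrt); exact: measurable_funB.
  - move=> s; rewrite /= in_itv/= andbT => as_; have s0 := lt_trans ha as_.
    by rewrite invr_gt0 mulr_gt0// sqrtr_gt0 subr_gt0 ltr_pXn2r// nnegrE ltW.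
  - by move=> t _; apply: e0; rewrite !divr_gt0.
  - by move=> t t0; exact: craig_hyperbola.
(* [pi] is generalized in both identities because [field] unfolds it. *)
have theta_cst : 2 / pi * (pi / 2) = 1 :> R.
  by move: (pi : R) p0 => p p0; field; rewrite gt_eqF.
have s_cst : 2 * a / pi * (pi / 2 / a) = 1 :> R.
  by move: (pi : R) p0 => p p0; field; rewrite !gt_eqF.
by rewrite secI hypI !muleA -!EFinM theta_cst s_cst !mul1e.
Qed.
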